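(* Let $\theta>0$, let $(\rho_\ell)_{\ell\ge1}$ be the lag-$\ell$ autocorrelations of a stationary real-valued process with finite positive variance and convergent autocorrelation sum, and let $k\ge1$ be an integer. Put $R_k=\sum_{\ell=1}^\infty\rho_{k\ell}$. Suppose that $$\rho_1\ge\rho_2\ge\rho_3\ge\cdots\ge0.$$ If $\mathrm{eff}(k)<1$, then $\theta<\dfrac{1}{2R_k}$ (where $1/(2R_k)$ is interpreted as $+\infty$ when $R_k=0$).
   Context: Setting: $(y_t)$ is a stationary real-valued process (a function $y_t=f(x_t)$ of a Markov chain $x_t$) with $0<\mathrm{var}(y_t)<\infty$ and autocorrelations $\rho_\ell=\mathrm{cor}(y_t,y_{t+\ell})$, $\ell\ge1$, with $\sum_{\ell\ge1}\rho_\ell$ convergent. Advancing the chain costs one unit and evaluating $f$ costs $\theta>0$ units. For an integer $k\ge1$, the (asymptotic) efficiency of thinning to every $k$-th observation relative to not thinning is $$\mathrm{eff}(k)=\frac{1+\theta}{k+\theta}\cdot\frac{1+2\sum_{\ell=1}^\infty\rho_\ell}{1+2\sum_{\ell=1}^\infty\rho_{k\ell}}.$$ *)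

(* Defs.v *)
(* MathComp-Analysis *)
From HB Require Import structures.
From mathcomp Require Import all_boot all_order all_algebra.
From mathcomp Require Import all_classical all_reals all_analysis.

Set Implicit Arguments.
Unset Strict Implicit.
Unset Printing Implicit Defensive.

Import Order.TTheory GRing.Theory Num.Theory.
Import numFieldNormedType.Exports.

Local Open Scope classical_set_scope.
Local Open Scope ring_scope.

(* Strict stationarity: the law of (y_{t_1}, ..., y_{t_n}) on R^n is the law of
   (y_{t_1 + h}, ..., y_{t_n + h}). *)
Definition stationary (d : measure_display) (T : measurableType d)
    (R : realType) (P : probability T R) (y : nat -> {RV P >-> R}) : Prop :=
  forall (n : nat) (t : n.-tuple nat) (h : nat) (A : set (n.-tuple R)),
    measurable A ->
    P ((fun w : T => [tuple y (tnth t i + h)%N w | i < n]) @^-1` A) =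
    P ((fun w : T => [tuple y (tnth t i) w | i < n]) @^-1` A).

(* Meaningful when both variances are finite and positive, which is when the
   projections [fine] and the division are not used at junk values. *)
Definition correlation (d : measure_display) (T : measurableType d)
    (R : realType) (P : probability T R) (X Y : T -> R) : R :=
  fine (covariance P X Y) /
  (Num.sqrt (fine 'V_P[X]) * Num.sqrt (fine 'V_P[Y])).

(* R_k = \sum_(l >= 1) rho_(k l), the limit of the partial sums over
   1 <= l < n; the value rho 0 is never used when k >= 1. *)
Definition lag_sum (R : realType) (rho : nat -> R) (k : nat) : R :=
  limn (fun n : nat => \sum_(1 <= l < n) rho (k * l)%N).

Definition eff (R : realType) (theta : R) (rho : nat -> R) (k : nat) : R :=
  (1 + theta) / (k%:R + theta) *
  ((1 + 2 * limn (fun n : nat => \sum_(1 <= l < n) rho l)) /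
   (1 + 2 * lag_sum rho k)).

(* Main.v *)
(* By monotonicity each rho_(k l) is at most the average of the k terms
   rho_(k (l - 1) + 1), ..., rho_(k l), so k R_k <= R_1.  Substituting this in
   eff(k) < 1, i.e. (1 + theta) (1 + 2 R_1) < (k + theta) (1 + 2 R_k), leaves
   (k - 1) 2 theta R_k < k - 1. *)
Require Import Defs.
From HB Require Import structures.
From mathcomp Require Import all_boot all_order all_algebra.
From mathcomp Require Import all_classical all_reals all_analysis.
From mathcomp Require Import lra.

Import Order.TTheory GRing.Theory Num.Theory.
Import numFieldNormedType.Exports.

Local Open Scope classical_set_scope.
Local Open Scope ring_scope.

(** Induction on [n]: each step adds the block of [k] indices from [k * n + 1] to [k * n.+1], whose
    smallest term is the last one. *)
Lemma mul_sum_multiples_le (R : numDomainType) (u : nat -> R) (k n : nat)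
    (u_noninc : forall l, (1 <= l)%N -> u l.+1 <= u l) :
  k%:R * \sum_(1 <= l < n.+1) u (k * l)%N <= \sum_(1 <= l < (k * n).+1) u l.
Proof.
have u_le i j : (1 <= i)%N -> (i <= j)%N -> u j <= u i.
  move=> i1; elim: j => [|j IHj]; first by rewrite leqNgt i1.
  rewrite leq_eqVlt => /predU1P[-> //|]; rewrite ltnS => ij.
  exact: le_trans (u_noninc _ (leq_trans i1 ij)) (IHj ij).
elim: n => [|n IHn]; first by rewrite muln0 !big_geq // mulr0.
rewrite big_nat_recr //= mulrDr [leRHS](@big_cat_nat _ _ _ (k * n).+1) //=; last first.
  by rewrite ltnS leq_mul2l leqnSn orbT.
apply: lerD => //.
(* Spreading the multiple as a constant sum over the block makes the comparison termwise. *)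
have -> : k%:R * u (k * n.+1)%N =
    \sum_((k * n).+1 <= l < (k * n.+1).+1) u (k * n.+1)%N.
  by rewrite sumr_const_nat subSS -mulnBr subSnn muln1 mulr_natl.
apply: ler_sum_nat => l /andP[ln lk]; apply: u_le => //.
exact: leq_ltn_trans ln.
Qed.

Section LagSum.
Context (R : realType) (rho : nat -> R) (k : nat).
Hypothesis k_gt0 : (1 <= k)%N.
Hypothesis rho_ge0 : forall l, (1 <= l)%N -> 0 <= rho l.
Hypothesis rho_noninc : forall l, (1 <= l)%N -> rho l.+1 <= rho l.
Hypothesis rho_cvg : cvgn (fun n : nat => \sum_(1 <= l < n) rho l).

(** General [j] covers both the full series ([j = 1]) and the thinned one ([j = k]). *)
Let partial_sum_nondecreasing j : (1 <= j)%N ->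
  nondecreasing_seq (fun n : nat => \sum_(1 <= l < n) rho (j * l)%N).
Proof.
move=> j1; apply/nondecreasing_seqP => -[|n]; first by rewrite !big_geq.
by rewrite [leRHS]big_nat_recr //= lerDl rho_ge0 // muln_gt0 j1.
Qed.

Let mul_partial_sum_le n :
  k%:R * \sum_(1 <= l < n) rho (k * l)%N <=
  limn (fun n : nat => \sum_(1 <= l < n) rho l).
Proof.
have ndS : nondecreasing_seq (fun n : nat => \sum_(1 <= l < n) rho l).
  move=> i j /(partial_sum_nondecreasing _ (leqnn 1)).
  by under eq_bigr do rewrite mul1n; under [leRHS]eq_bigr do rewrite mul1n.
(* The finite inequality has upper bound [n.+1]; at [0] the left side is an empty sum, and the limit
   dominates the empty partial sum. *)
case: n => [|n].
  rewrite big_geq // mulr0.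
  by apply: le_trans (nondecreasing_cvgn_le ndS rho_cvg 0%N); rewrite big_geq.
apply: le_trans (mul_sum_multiples_le _ _ _ _ rho_noninc) _.
exact: nondecreasing_cvgn_le.
Qed.

(** Monotone convergence, with the full sum divided by [k] as upper bound; this makes [lag_sum] a
    genuine limit rather than a default value. *)
Let lag_sum_cvg : cvgn (fun n : nat => \sum_(1 <= l < n) rho (k * l)%N).
Proof.
apply: nondecreasing_is_cvgn; first exact: partial_sum_nondecreasing.
exists ((limn (fun n : nat => \sum_(1 <= l < n) rho l)) / k%:R) => _ [n _ <-].
by rewrite ler_pdivlMr ?ltr0n // mulrC mul_partial_sum_le.
Qed.

Lemma lag_sum_ge0 : 0 <= lag_sum rho k.
Proof.
have := nondecreasing_cvgn_le (partial_sum_nondecreasing _ k_gt0) lag_sum_cvg 0%N.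
by rewrite big_geq.
Qed.

Lemma mul_lag_sum_le :
  k%:R * lag_sum rho k <= limn (fun n : nat => \sum_(1 <= l < n) rho l).
Proof.
rewrite mulrC -ler_pdivlMr ?ltr0n //; apply: limr_le => //.
by apply: nearW => n; rewrite ler_pdivlMr ?ltr0n // mulrC mul_partial_sum_le.
Qed.

End LagSum.

(* In \bar R the inverse satisfies 0^-1 = +oo (library lemma inve0). *)
Theorem theorem1 (R : realType) (d : measure_display) (T : measurableType d)
    (P : probability T R) (y : nat -> {RV P >-> R}) (rho : nat -> R)
    (theta : R) (k : nat)
    (htheta : 0 < theta)
    (hk : (1 <= k)%N)
    (hstat : stationary y)
    (hvar : forall t : nat, (0 < 'V_P[y t] < +oo)%E)
    (hrho : forall t l : nat, (1 <= l)%N ->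
       rho l = correlation P (y t) (y (t + l)%N))
    (hsum : cvgn (fun n : nat => \sum_(1 <= l < n) rho l))
    (hmono : forall l : nat, (1 <= l)%N -> rho l.+1 <= rho l)
    (hge0 : forall l : nat, (1 <= l)%N -> 0 <= rho l) :
  eff theta rho k < 1 ->
  (theta%:E < ((2 * lag_sum rho k)%:E)^-1)%E.
Proof.
have L0 := lag_sum_ge0 _ _ _ hk hge0 hmono hsum.
have := mul_lag_sum_le _ _ _ hk hge0 hmono hsum.
rewrite /eff; set S := limn _; set L := lag_sum rho k in L0 * => kL_S.
have k1 : 1 <= k%:R :> R by rewrite ler1n.
have kt : 0 < k%:R + theta by lra.
have L1 : 0 < 1 + 2 * L by lra.
rewrite mulf_div ltr_pdivrMr ?mulr_gt0 // mul1r => eff_lt1.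
(* Lowering [S] to [k%:R * L] only decreases the left side, since [1 + theta] is positive. *)
have {}eff_lt1 : (1 + theta) * (1 + 2 * (k%:R * L)) < (k%:R + theta) * (1 + 2 * L).
  by apply: le_lt_trans eff_lt1; rewrite ler_pM2l; lra.
have thetaL : theta * (2 * L) < 1.
  rewrite ltNge; apply/negP => thetaL.
  (* This product is exactly the left side minus the right side of [eff_lt1], hence negative; this
     also settles [k = 1], where it vanishes. *)
  have : 0 <= (k%:R - 1) * (theta * (2 * L) - 1) by rewrite mulr_ge0 ?subr_ge0.
  lra.
(* For [L = 0] the bound is [+oo]; otherwise the extended inverse is the real one and [thetaL] can
   be divided by [2 * L]. *)
have [->|L_neq0] := eqVneq L 0; first by rewrite mulr0 inve0 ltry.
have L_gt0 : 0 < L by rewrite lt0r L_neq0.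
by rewrite inver mulf_eq0 pnatr_eq0 (negbTE L_neq0) /= lte_fin -[ltRHS]mul1r
  ltr_pdivlMr // mulr_gt0.
Qed.
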